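(* Let $P$ be a combinatorial specification all of whose rules are produced by productive strategies. Then the reliance graph of $P$ has no infinite directed walk.
   Context: A combinatorial set is a set of objects each with a size in $\mathbb{N}$, finitely many of each size; $\mathcal{A}_n$ denotes its objects of size $n$. An $m$-ary combinatorial strategy $S$ ($m\ge0$) consists of: a decomposition function $d_S$ sending each combinatorial set either to an $m$-tuple of combinatorial sets or to the symbol DNA; a reliance profile function $r_S:\mathbb{N}\to\mathbb{Z}^m$, $r_S(n)=(r^{(1)}_S(n),\ldots,r^{(m)}_S(n))$; and counting functions $c_{S,(n)}$ such that whenever $d_S(\mathcal{A})=(\mathcal{B}^{(1)},\ldots,\mathcal{B}^{(m)})$, $c_{S,(n)}$ applied to the tuples $(|\mathcal{B}^{(i)}_0|,\ldots,|\mathcal{B}^{(i)}_{r^{(i)}_S(n)}|)$, $i=1,\ldots,m$, equals $|\mathcal{A}_n|$. If $d_S(\mathcal{A})=(\mathcal{B}^{(1)},\ldots,\mathcal{B}^{(m)})$ we get the rule $\mathcal{A}\xleftarrow{S}(\mathcal{B}^{(1)},\ldots,\mathcal{B}^{(m)})$, and we say $\mathcal{A}_N$ relies on $\mathcal{B}^{(i)}_j$ if $0\le j\le r^{(i)}_S(N)$. A combinatorial specification is a set of rules such that every set appearing on a right-hand side is the left-hand side of exactly one rule. The reliance graph of a specification has vertices $\mathcal{B}_k$ for every set $\mathcal{B}$ of the specification and every $k\in\mathbb{N}$, and an edge $\mathcal{A}_N\to\mathcal{B}^{(i)}_j$ whenever $\mathcal{A}\xleftarrow{S}(\mathcal{B}^{(1)},\ldots,\mathcal{B}^{(m)})$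 is the rule with left-hand side $\mathcal{A}$ and $\mathcal{A}_N$ relies on $\mathcal{B}^{(i)}_j$. A strategy $S$ is productive if for every combinatorial set $\mathcal{A}$ with $d_S(\mathcal{A})=(\mathcal{B}^{(1)},\ldots,\mathcal{B}^{(m)})$ and every $i\in\{1,\ldots,m\}$: (1) for all $N\in\mathbb{N}$, if $\mathcal{A}_N$ relies on $\mathcal{B}^{(i)}_j$ then $j\le N$; (2) if $\mathcal{A}_N$ relies on $\mathcal{B}^{(i)}_N$ for some $N$, then (a) $|\mathcal{A}_n|\ge|\mathcal{B}^{(i)}_n|$ for all $n\in\mathbb{N}$ and (b) $|\mathcal{A}_\ell|>|\mathcal{B}^{(i)}_\ell|$ for some $\ell\in\mathbb{N}$.
   Formalization: The specification is assumed to be a finite set of rules; with infinitely many rules the claim fails, e.g. for rules A^(k) ← (A^(k+1)) with reliance n ↦ n, where A^(k) has one object of each size n ≥ k. *)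

(* Defs.v *)
From mathcomp Require Import all_boot all_order all_algebra.
From mathcomp Require Import finmap boolp classical_sets functions cardinality.

Set Implicit Arguments.
Unset Strict Implicit.
Unset Printing Implicit Defensive.

Local Open Scope classical_set_scope.

(* The objects are drawn from an arbitrary ambient type [T], so that equality
   of combinatorial sets is equality of subsets of [T] together with their size
   functions, rather than equality of types. *)
Record combset (T : Type) := CombSet {
  carrier : set T;
  objsize : set_type carrier -> nat;
  finite_objsize : forall n, finite_set [set x | objsize x = n]
}.

Definition level (T : Type) (A : combset T) (n : nat) : set T :=
  [set val x | x in [set x | @objsize T A x = n]].

(* [fset_set] is only meaningful on finite sets, which [finite_objsize]
   guarantees here; [{classic T}] is [T] with its classical choice structure. *)
Definition card_level (T : Type) (A : combset T) (n : nat) : nat :=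
  #|` fset_set (level A n : set {classic T}) |.

(* (|B_0|, ..., |B_r|), which is empty when r < 0. *)
Definition level_counts (T : Type) (B : combset T) (r : int) : seq nat :=
  if r is Posz k then [seq card_level B j | j <- iota 0 k.+1] else [::].

(* [decomp A = None] stands for d_S(A) = DNA. The i-th argument of the counting
   function [counting n] ranges over all finite sequences of naturals; only its
   values on sequences of length r^(i)(n) + 1 are constrained and used. *)
Record strategy (T : Type) (m : nat) := Strategy {
  decomp : combset T -> option (m.-tuple (combset T));
  reliance : nat -> m.-tuple int;
  counting : nat -> m.-tuple (seq nat) -> nat;
  countingE : forall (A : combset T) (B : m.-tuple (combset T)) (n : nat),
    decomp A = Some B ->
    counting n [tuple level_counts (tnth B i) (tnth (reliance n) i) | i < m] =
    card_level A n
}.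

(* For a rule A <-S- (B^(1), ..., B^(m)), whether A_N relies on B^(i)_j depends
   only on S, N, i and j. *)
Definition relies_on (T : Type) (m : nat) (S : strategy T m)
    (N : nat) (i : 'I_m) (j : nat) : Prop :=
  (j%:Z <= tnth (reliance S N) i)%R.

Record rule (T : Type) := Rule {
  arity : nat;
  rule_strategy : strategy T arity;
  lhs : combset T;
  rhs : arity.-tuple (combset T);
  rule_decomp : decomp rule_strategy lhs = Some rhs
}.

Definition in_rhs (T : Type) (R : rule T) (B : combset T) : Prop :=
  exists i : 'I_(arity R), tnth (rhs R) i = B.

(* Specifications are finite. With infinitely many rules, let A^(k) have one
   object of each size n >= k, and let S_k be the unary strategy with
   A^(k) <-S_k- (A^(k+1)), reliance profile n |-> n and counting functions
   constant equal to |A^(k)_n|: every S_k is productive, but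
   A^(0)_0 -> A^(1)_0 -> A^(2)_0 -> ... is an infinite walk. *)
Definition specification (T : Type) (P : set (rule T)) : Prop :=
  finite_set P /\
  forall (R : rule T) (B : combset T), P R -> in_rhs R B ->
    exists! R' : rule T, P R' /\ lhs R' = B.

Definition spec_sets (T : Type) (P : set (rule T)) : set (combset T) :=
  [set B | exists R, P R /\ (lhs R = B \/ in_rhs R B)].

(* The pair (B, k) represents the vertex B_k. *)
Definition reliance_vertex (T : Type) (P : set (rule T)) :
    set (combset T * nat) :=
  [set v | spec_sets P v.1].

Definition reliance_edge (T : Type) (P : set (rule T))
    (u v : combset T * nat) : Prop :=
  exists (R : rule T) (i : 'I_(arity R)),
    [/\ P R, lhs R = u.1, tnth (rhs R) i = v.1 &
        relies_on (rule_strategy R) u.2 i v.2].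

Definition infinite_walk (V : Type) (vertex : set V) (edge : V -> V -> Prop)
    (w : nat -> V) : Prop :=
  forall k, vertex (w k) /\ edge (w k) (w k.+1).

Definition productive (T : Type) (m : nat) (S : strategy T m) : Prop :=
  forall (A : combset T) (B : m.-tuple (combset T)),
    decomp S A = Some B ->
    forall i : 'I_m,
      (forall N j : nat, relies_on S N i j -> j <= N) /\
      ((exists N : nat, relies_on S N i N) ->
        (forall n : nat, card_level A n >= card_level (tnth B i) n) /\
        (exists l : nat, card_level A l > card_level (tnth B i) l)).

(* Main.v *)
Require Import Defs.
From mathcomp Require Import all_boot all_order all_algebra.
From mathcomp Require Import finmap boolp classical_sets functions cardinality.

(** Along a walk the size index never increases, so it is eventually constant.
    From then on every step goes from [A_N] to some [B_N], so productivity makes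
    the counting sequences strictly decrease in the pointwise order. The sets
    visited are therefore pairwise distinct, yet all of them are among the
    finitely many left-hand sides. *)

Local Open Scope classical_set_scope.

Lemma nonincreasing_nat_stationary (f : nat -> nat) :
  (forall k, f k.+1 <= f k) -> exists K, forall k, f (K + k) = f K.
Proof.
move=> f_dec.
have f_mono K k : f (K + k) <= f K.
  by elim: k => [|k IHk]; rewrite ?addn0 // addnS (leq_trans (f_dec _)).
have [m] := ubnP (f 0); move: 0 => K; elim: m K => // m IHm K ltKm.
have [fK|] := pselect (forall k, f (K + k) = f K); first by exists K.
move=> /existsNP[k /eqP neq_fk]; apply: (IHm (K + k)).
by rewrite -ltnS (leq_trans _ ltKm) // ltnS ltn_neqAle neq_fk f_mono.
Qed.

Lemma pointwise_decreasing_injective (I : Type) (F : nat -> I -> nat) :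
  (forall k i, F k.+1 i <= F k i) -> (forall k, exists i, F k.+1 i < F k i) ->
  injective F.
Proof.
move=> F_le F_lt.
have F_mono a d i : F (a + d) i <= F a i.
  by elim: d => [|d IHd]; rewrite ?addn0 // addnS (leq_trans (F_le _ _)).
have F_neq a b : a < b -> F a <> F b.
  move=> lt_ab eqF; have [i] := F_lt a.
  by rewrite eqF -(subnKC lt_ab) ltnNge F_mono.
move=> a b eqF; case: (ltngtP a b) => // [/F_neq[]|/F_neq[]] //.
Qed.

Lemma finite_set_no_injective_sequence (V : Type) (X : set V) (f : nat -> V) :
  finite_set X -> injective f -> ~ (forall k, X (f k)).
Proof.
move=> finX f_inj Xf; apply: infinite_nat.
suff -> : [set: nat] = f @^-1` X.
  by apply: finite_preimage finX => a b _ _; exact: f_inj.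
by apply/seteqP; split => k // _; exact: Xf.
Qed.

Theorem theorem4p4 (T : Type) (P : set (rule T)) :
  specification P ->
  (forall R : rule T, P R -> productive (rule_strategy R)) ->
  ~ (exists w : nat -> combset T * nat,
       infinite_walk (reliance_vertex P) (reliance_edge P) w).
Proof.
move=> [finP _] prodP [w walk_w].
have [K wK] : exists K, forall k, (w (K + k)).2 = (w K).2.
  apply: (@nonincreasing_nat_stationary (fun k => (w k).2)) => k.
  have [_ [R [i [PR _ _ rel_i]]]] := walk_w k.
  by have [+ _] := prodP R PR _ _ (rule_decomp R) i; exact.
pose A k := (w (K + k)).1.
have A_dec k : (forall n, card_level (A k.+1) n <= card_level (A k) n) /\
    (exists l, card_level (A k.+1) l < card_level (A k) l).
  have [_ [R [i [PR lhsR rhsR]]]] := walk_w (K + k).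
  rewrite -addnS !wK => rel_i; rewrite /A -lhsR addnS -rhsR.
  have [_] := prodP R PR _ _ (rule_decomp R) i.
  by apply; exists (w K).2.
apply: (@finite_set_no_injective_sequence _ ((@lhs T) @` P) A).
- exact: finite_image.
- have F_inj := @pointwise_decreasing_injective _ (fun k => card_level (A k))
    (fun k => (A_dec k).1) (fun k => (A_dec k).2).
  by move=> a b eqA; apply: F_inj; rewrite eqA.
- by move=> k; have [_ [R [i [PR lhsR _ _]]]] := walk_w (K + k); exists R.
Qed.
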